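(* Let $\mathbb I=[t_0,t_f]\subset\mathbb R$ be a compact interval and consider a pHDAE system $$E\dot x=[(J-R)Q-EK]x+(B-P)u,\qquad y=(B+P)^TQx+(S+N)u$$ on $\mathbb I$ with Hamiltonian $\mathcal H(x)=\frac12x^TQ^TEx$. Let $U\in C^0(\mathbb I,\mathbb R^{n,n})$ and $V\in C^1(\mathbb I,\mathbb R^{n,n})$ be pointwise invertible in $\mathbb I$. Then the transformed DAE $$\tilde E\dot{\tilde x}=[(\tilde J-\tilde R)\tilde Q-\tilde E\tilde K]\tilde x+(\tilde B-\tilde P)u,\qquad y=(\tilde B+\tilde P)^T\tilde Q\tilde x+(S+N)u,$$ with $$\tilde E=U^TEV,\quad \tilde Q=U^{-1}QV,\quad \tilde J=U^TJU,\quad \tilde R=U^TRU,\quad \tilde B=U^TB,\quad \tilde P=U^TP,$$ $$\tilde K=V^{-1}KV+V^{-1}\dot V,\qquad x=V\tilde x,$$ is still a pHDAE system with the same Hamiltonian $$\tilde{\mathcal H}(\tilde x)=\tfrac12\tilde x^T\tilde Q^T\tilde E\tilde x=\mathcal H(x).$$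
   Context: $C^j(\mathbb I,\mathcal X)$ denotes the set of $j$-times continuously differentiable functions from $\mathbb I$ to $\mathcal X$; the argument $t$ of the coefficient functions is suppressed. Definition (pHDAE). A linear variable coefficient descriptor system $$E\dot x=[(J-R)Q-EK]x+(B-P)u,\qquad y=(B+P)^TQx+(S+N)u$$ with $E,Q\in C^1(\mathbb I,\mathbb R^{n,n})$, $J,R,K\in C^0(\mathbb I,\mathbb R^{n,n})$, $B,P\in C^0(\mathbb I,\mathbb R^{n,m})$, $S=S^T,\ N=-N^T\in C^0(\mathbb I,\mathbb R^{m,m})$ is called a port-Hamiltonian descriptor system (port-Hamiltonian differential-algebraic system, pHDAE) if: i) the differential-algebraic operator $\mathcal L=Q^TE\frac{d}{dt}-(Q^TJQ-Q^TEK):\mathcal D\subset C^1(\mathbb I,\mathbb R^n)\to C^0(\mathbb I,\mathbb R^n)$ is skew-adjoint, i.e. $Q^TE\in C^1(\mathbb I,\mathbb R^{n,n})$ and for all $t\in\mathbb I$: $Q^TE=E^TQ$ and $\frac{d}{dt}(Q^TE)=Q^T[EK-JQ]+[EK-JQ]^TQ$; ii) the Hamiltonian $\mathcal H(x)=\frac12x^TQ^TEx$ is bounded from below by a constant, i.e. there is $h_0\in\mathbb R$ with $\mathcal H(x(t))\ge h_0$ uniformly for all $t\in\mathbb I$ and all solutions $x$ of the system; iii) the matrix function $W=\begin{bmatrix}Q^TRQ&Q^TP\\P^TQ&S\end{bmatrix}\in C^0(\mathbb I,\mathbb R^{n+m,n+m})$ is positive semidefinite, i.e. $W(t)=W(t)^T\ge0$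 for all $t\in\mathbb I$.
   Formalization: For U only continuous, the transformed E and Q are claimed only continuous (Q^T E stays C^1), since C^1 can fail (E=Q=V=1, U not C^1); if the original E, Q and also U are C^1, the full pHDAE definition is proved. The interval has t_0<t_f. *)

(* Defs.v *)
From HB Require Import structures.
From mathcomp Require Import all_boot all_order all_algebra.
From mathcomp Require Import all_classical all_reals all_analysis.

Set Implicit Arguments.
Unset Strict Implicit.
Unset Printing Implicit Defensive.

Import Order.TTheory GRing.Theory Num.Theory.
Import numFieldNormedType.Exports.

Local Open Scope classical_set_scope.
Local Open Scope ring_scope.

(* Calculus on a subset I of the line: functions are total on R, but only their
   values on I matter; at an endpoint of I the derivative is one-sided. *)
Section Calculus.
Variables (R : realType) (V : normedModType R) (I : set R).
Implicit Types f : R -> V.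

Definition diff_quot f (t s : R) : V := (s - t)^-1 *: (f s - f t).

Definition derivable_on f : Prop :=
  forall t, I t -> cvg (diff_quot f t @ within I t^').

Definition deriv_on f (t : R) : V := lim (diff_quot f t @ within I t^').

Fixpoint Ck (k : nat) f : Prop :=
  if k is k'.+1 then derivable_on f /\ Ck k' (deriv_on f)
  else {within I, continuous f}.

End Calculus.

Section PHDAE.
Variable R : realType.

Definition psd_mx (k : nat) (W : 'M[R]_k) : Prop :=
  W = W^T /\ forall v : 'cV[R]_k, 0 <= (v^T *m W *m v) ord0 ord0.

(* Coefficients of
     E x' = [(J - R) Q - E K] x + (B - P) u,
     y    = (B + P)^T Q x + (S + N) u. *)
Record descriptor_system (n m : nat) := DescriptorSystem {
  sE : R -> 'M[R]_n;
  sQ : R -> 'M[R]_n;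
  sJ : R -> 'M[R]_n;
  sR : R -> 'M[R]_n;
  sK : R -> 'M[R]_n;
  sB : R -> 'M[R]_(n, m);
  sP : R -> 'M[R]_(n, m);
  sS : R -> 'M[R]_m;
  sN : R -> 'M[R]_m
}.

Variables (n m : nat) (I : set R).
Implicit Types (sys : descriptor_system n m).

Definition is_solution sys
    (x : R -> 'cV[R]_n) (u y : R -> 'cV[R]_m) : Prop :=
  [/\ Ck I 1 x, Ck I 0 u &
      forall t, I t ->
        sE sys t *m deriv_on I x t =
          ((sJ sys t - sR sys t) *m sQ sys t - sE sys t *m sK sys t) *m x t
          + (sB sys t - sP sys t) *m u t
        /\ y t = (sB sys t + sP sys t)^T *m sQ sys t *m x t
                 + (sS sys t + sN sys t) *m u t].

Definition hamiltonian sys (t : R) (x : 'cV[R]_n) : R :=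
  2^-1 * (x^T *m (sQ sys t)^T *m sE sys t *m x) ord0 ord0.

(* Skew-adjointness of Q^T E d/dt - (Q^T J Q - Q^T E K). *)
Definition skew_adjoint_cond sys : Prop :=
  let QE := fun t => (sQ sys t)^T *m sE sys t in
  Ck I 1 QE /\
  forall t, I t ->
    QE t = (sE sys t)^T *m sQ sys t /\
    deriv_on I QE t =
      (sQ sys t)^T *m (sE sys t *m sK sys t - sJ sys t *m sQ sys t)
      + (sE sys t *m sK sys t - sJ sys t *m sQ sys t)^T *m sQ sys t.

Definition hamiltonian_bounded_below sys : Prop :=
  exists h0 : R, forall x u y, is_solution sys x u y ->
    forall t, I t -> h0 <= hamiltonian sys t (x t).

Definition passivity_mx sys (t : R) : 'M[R]_(n + m) :=
  block_mx ((sQ sys t)^T *m sR sys t *m sQ sys t) ((sQ sys t)^T *m sP sys t)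
           ((sP sys t)^T *m sQ sys t)             (sS sys t).

(* The parameter r is the regularity required of E and Q separately.  The usual
   definition is r = 1.  It is not invariant under E |-> U^T E V with U merely
   continuous (take E = Q = V = 1, all other coefficients 0, and U a continuous
   positive scalar function which is not C^1), whereas r = 0 is; in both cases
   Q^T E is C^1, by skew_adjoint_cond.  See pHDAE1_0 for r = 1 implies r = 0. *)
Definition pHDAE (r : nat) sys : Prop :=
  [/\ [/\ Ck I r (sE sys), Ck I r (sQ sys),
          Ck I 0 (sJ sys), Ck I 0 (sR sys) & Ck I 0 (sK sys)],
      [/\ Ck I 0 (sB sys), Ck I 0 (sP sys), Ck I 0 (sS sys), Ck I 0 (sN sys) &
          forall t, I t -> sS sys t = (sS sys t)^T /\ sN sys t = - (sN sys t)^T],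
      skew_adjoint_cond sys,
      hamiltonian_bounded_below sys &
      Ck I 0 (passivity_mx sys) /\
      forall t, I t -> psd_mx (passivity_mx sys t)].

Definition transform sys (U V : R -> 'M[R]_n) : descriptor_system n m := {|
  sE := fun t => (U t)^T *m sE sys t *m V t;
  sQ := fun t => invmx (U t) *m sQ sys t *m V t;
  sJ := fun t => (U t)^T *m sJ sys t *m U t;
  sR := fun t => (U t)^T *m sR sys t *m U t;
  sK := fun t => invmx (V t) *m sK sys t *m V t
                 + invmx (V t) *m deriv_on I V t;
  sB := fun t => (U t)^T *m sB sys t;
  sP := fun t => (U t)^T *m sP sys t;
  sS := sS sys;
  sN := sN sys |}.

End PHDAE.

Lemma derivable_on_continuous (R : realType) (V : normedModType R) (I : set R)
    (f : R -> V) : derivable_on I f -> {within I, continuous f}.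
Proof.
move=> df; apply/subspace_continuousP => t It.
have /cvg_ex[l fl] := df t It.
have st : (s - t) @[s --> within I t^'] --> (0 : R).
  rewrite -(subrr t); apply: cvgB; last exact: cvg_cst.
  have tt : id @ t^' --> t by exact: cvg_within.
  by move=> A /tt At; exact: filterS At.
have fc : f s @[s --> within I t^'] --> f t.
  have qf : {near within I t^',
      (fun s => (s - t) *: diff_quot f t s + f t) =1 f}.
    rewrite near_withinE; near=> s => _ /=.
    rewrite /diff_quot scalerA divff ?scale1r ?subrK// subr_eq0.
    by near: s; exact: nbhs_dnbhs_neq.
  have := cvgD (cvgZ st fl) (cvg_cst (f t)).
  by rewrite scale0r add0r => h A /h; exact: near_eq_cvg.
move=> A fA; apply: (@filterS _ (nbhs t) _ _ _ _ (fc A fA)) => s /= H Is.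
have [->|st0] := eqVneq s t; last exact: H.
exact: (@nbhs_singleton V).
Unshelve. all: by end_near. Qed.

Lemma pHDAE1_0 (R : realType) (n m : nat) (I : set R)
    (sys : descriptor_system R n m) : pHDAE I 1 sys -> pHDAE I 0 sys.
Proof.
by case=> -[[/derivable_on_continuous ? _] [/derivable_on_continuous ? _] *].
Qed.

(* Main.v *)
(* Everything reduces to the pointwise identities Q'^T E' = V^T (Q^T E) V and
   W' = diag(V, 1)^T W diag(V, 1), and to the cancellation of U^T in the state
   equation.  Differentiating V^T (Q^T E) V produces exactly the terms that the
   summand V^-1 (dV/dt) of K' contributes to the skew-adjointness condition.  Only
   Q^T E is ever differentiated, so U need not be differentiable. *)

Require Import Defs.
From mathcomp Require Import all_boot all_order all_algebra.
From mathcomp Require Import all_classical all_reals all_analysis.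

Set Implicit Arguments.
Unset Strict Implicit.
Unset Printing Implicit Defensive.

Import Order.TTheory GRing.Theory Num.Theory.
Import numFieldNormedType.Exports.

Local Open Scope classical_set_scope.
Local Open Scope ring_scope.

(** * Limits of matrix operations along a filter *)

Section MatrixLimits.
Context {R : realType} {T : Type} {F : set_system T} {FF : Filter F}.

(** Matrix balls are entrywise, and the finitely many eventual conditions on the entries combine
    into one. *)
Lemma cvg_mxP m n (f : T -> 'M[R]_(m, n)) (A : 'M[R]_(m, n)) :
  f x @[x --> F] --> A <-> forall i j, f x i j @[x --> F] --> A i j.
Proof.
split=> [fA i j|fA].
  exact: (continuous_cvg _ (@coord_continuous R m n i j A) fA).
apply/cvg_ballP => e e0.
have fe : \forall x \near F, forall i j, ball (A i j) e (f x i j).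
  apply: filter_forall => i; apply: filter_forall => j.
  by have /cvg_ballP := fA i j; apply.
by apply: filterS fe => x fx; split.
Qed.

Lemma cvg_mulmx m n p (f : T -> 'M[R]_(m, n)) (g : T -> 'M[R]_(n, p))
    (A : 'M[R]_(m, n)) (B : 'M[R]_(n, p)) :
  f x @[x --> F] --> A -> g x @[x --> F] --> B ->
  (f x *m g x) @[x --> F] --> A *m B.
Proof.
move=> /cvg_mxP fA /cvg_mxP gB; apply/cvg_mxP => i j; rewrite mxE.
under eq_cvg do rewrite mxE.
apply: cvg_big => [|k _]; first exact: add_continuous.
exact: cvgM.
Qed.

Lemma cvg_trmx m n (f : T -> 'M[R]_(m, n)) (A : 'M[R]_(m, n)) :
  f x @[x --> F] --> A -> (f x)^T @[x --> F] --> A^T.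
Proof.
move=> /cvg_mxP fA; apply/cvg_mxP => i j; rewrite mxE.
by under eq_cvg do rewrite mxE; exact: fA.
Qed.

(** By the Leibniz formula the determinant is a finite sum of signed products of entries. *)
Lemma cvg_det n (f : T -> 'M[R]_n) (A : 'M[R]_n) :
  f x @[x --> F] --> A -> \det (f x) @[x --> F] --> \det A.
Proof.
move=> /cvg_mxP fA; apply: cvg_big => [|s _]; first exact: add_continuous.
apply: cvgM; first exact: cvg_cst.
by apply: cvg_big => // ; exact: mul_continuous.
Qed.

(** Cramer's rule: the inverse is the adjugate divided by the determinant, and both converge. *)
Lemma cvg_invmx n (f : T -> 'M[R]_n) (A : 'M[R]_n) : A \in unitmx ->
  f x @[x --> F] --> A -> invmx (f x) @[x --> F] --> invmx A.
Proof.
rewrite unitmxE unitfE => detA fA.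
have detf := cvg_det fA.
(* [invmx] returns a singular matrix unchanged, so the adjugate formula is available only where
   [f x] is invertible, which holds eventually since [\det A] is nonzero. *)
have fU : \forall x \near F, f x \in unitmx.
  near=> x; rewrite unitmxE unitfE; near: x; exact: cvgr_neq0 detf detA.
have adjf : ((\det (f x))^-1 *: \adj (f x)) @[x --> F] --> invmx A.
  rewrite /invmx unitmxE unitfE detA.
  apply: cvgZ; first exact: cvgV.
  apply/cvg_mxP => i j; rewrite mxE.
  under eq_cvg do rewrite mxE.
  apply: cvgM; first exact: cvg_cst.
  apply: cvg_det; apply/cvg_mxP => k l; rewrite !mxE.
  under eq_cvg do rewrite !mxE.
  by have /cvg_mxP := fA; apply.
apply: cvg_trans adjf; apply: near_eq_cvg; apply: filterS fU => x fx.
by rewrite /invmx fx.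
Unshelve. all: by end_near. Qed.

End MatrixLimits.

(** * Continuity and derivatives relative to a subset of the line *)

Section CalculusOnASet.
Context {R : realType} {V : normedModType R} {I : set R}.
Implicit Types f g : R -> V.

Lemma Ck0P f :
  Ck I 0 f <-> forall t, I t -> f s @[s --> within I (nbhs t)] --> f t.
Proof. exact: subspace_continuousP. Qed.

Lemma Ck1_Ck0 f : Ck I 1 f -> Ck I 0 f.
Proof. by case=> /derivable_on_continuous. Qed.

(** For [t] in [I], the quotients along this filter read only values on [I]. The identities for the
    transformed coefficients are known only there. *)
Lemma cvg_diff_quot_eq f g t (l : V) : (forall s, I s -> f s = g s) -> I t ->
  diff_quot f t @ within I t^' --> l -> diff_quot g t @ within I t^' --> l.
Proof.
move=> fg It; apply: cvg_trans; apply: fmap_within_eq => s /set_mem Is.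
by rewrite /diff_quot !fg.
Qed.

Lemma Ck0_eq f g : (forall s, I s -> f s = g s) -> Ck I 0 f -> Ck I 0 g.
Proof.
move=> fg /Ck0P fC; apply/Ck0P => t It; rewrite -fg//.
by apply: cvg_trans (fC t It); apply: fmap_within_eq => s /set_mem /fg.
Qed.

Lemma derivable_onP f t : derivable_on I f -> I t ->
  diff_quot f t @ within I t^' --> deriv_on I f t.
Proof. by move=> df /df. Qed.

Lemma Ck0_dnbhs f t : Ck I 0 f -> I t -> f s @[s --> within I t^'] --> f t.
Proof.
move=> /Ck0P fC It; apply: cvg_trans (fC t It).
by move=> A /=; rewrite /within /= => At; apply: nbhs_dnbhs.
Qed.

(* No point of I is isolated: derivatives along I are unique. *)
Hypothesis Iperfect : forall t, I t -> ProperFilter (within I t^').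

Lemma deriv_on_eq f t (l : V) : I t ->
  diff_quot f t @ within I t^' --> l -> deriv_on I f t = l.
Proof.
by move=> It; have FF := Iperfect It; apply: cvg_lim; exact: norm_hausdorff.
Qed.

(** Lets an explicit formula stand for [deriv_on], which is a [lim] and so is identified only
    through uniqueness of limits. *)
Lemma Ck1P f (f' : R -> V) :
  (forall t, I t -> diff_quot f t @ within I t^' --> f' t) ->
  Ck I 0 f' -> Ck I 1 f.
Proof.
move=> ff' f'C; split=> [t It|]; first exact: cvgP (ff' t It).
by apply: Ck0_eq f'C => t It; rewrite (@deriv_on_eq f t (f' t))//; exact: ff'.
Qed.

Lemma Ck1_eq f g : (forall s, I s -> f s = g s) -> Ck I 1 f -> Ck I 1 g.
Proof.
move=> fg [df f'C]; apply: Ck1P f'C => t It.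
exact: cvg_diff_quot_eq fg It (derivable_onP df It).
Qed.

End CalculusOnASet.

(** * Regularity and differentiation rules for matrix functions *)

Section MatrixCalculus.
Context {R : realType} {I : set R}.

Lemma Ck0_cst m n (A : 'M[R]_(m, n)) : Ck I 0 (fun=> A).
Proof. by apply/Ck0P => t It; exact: cvg_cst. Qed.

Lemma Ck0_add m n (f g : R -> 'M[R]_(m, n)) :
  Ck I 0 f -> Ck I 0 g -> Ck I 0 (fun t => f t + g t).
Proof.
by move=> /Ck0P fC /Ck0P gC; apply/Ck0P => t It; apply: cvgD; [exact: fC|exact: gC].
Qed.

Lemma Ck0_opp m n (f : R -> 'M[R]_(m, n)) : Ck I 0 f -> Ck I 0 (fun t => - f t).
Proof. by move=> /Ck0P fC; apply/Ck0P => t It; apply: cvgN; exact: fC. Qed.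

Lemma Ck0_mulmx m n p (f : R -> 'M[R]_(m, n)) (g : R -> 'M[R]_(n, p)) :
  Ck I 0 f -> Ck I 0 g -> Ck I 0 (fun t => f t *m g t).
Proof.
move=> /Ck0P fC /Ck0P gC; apply/Ck0P => t It.
by apply: cvg_mulmx; [exact: fC|exact: gC].
Qed.

Lemma Ck0_trmx m n (f : R -> 'M[R]_(m, n)) : Ck I 0 f -> Ck I 0 (fun t => (f t)^T).
Proof. by move=> /Ck0P fC; apply/Ck0P => t It; apply: cvg_trmx; exact: fC. Qed.

Lemma Ck0_block_mx m1 m2 n1 n2 (f : R -> 'M[R]_(m1, n1))
    (g : R -> 'M[R]_(m1, n2)) (h : R -> 'M[R]_(m2, n1)) (k : R -> 'M[R]_(m2, n2)) :
  Ck I 0 f -> Ck I 0 g -> Ck I 0 h -> Ck I 0 k ->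
  Ck I 0 (fun t => block_mx (f t) (g t) (h t) (k t)).
Proof.
move=> /Ck0P fC /Ck0P gC /Ck0P hC /Ck0P kC; apply/Ck0P => t It.
(* Each index is traced to its half, which places the entry in exactly one of the four blocks. *)
apply/cvg_mxP => i j; rewrite -(splitK i) -(splitK j).
case: (fintype.split i) => i' /=; case: (fintype.split j) => j' /=.
- rewrite block_mxEul; under eq_cvg do rewrite block_mxEul.
  by have /cvg_mxP := fC t It; apply.
- rewrite block_mxEur; under eq_cvg do rewrite block_mxEur.
  by have /cvg_mxP := gC t It; apply.
- rewrite block_mxEdl; under eq_cvg do rewrite block_mxEdl.
  by have /cvg_mxP := hC t It; apply.
- rewrite block_mxEdr; under eq_cvg do rewrite block_mxEdr.
  by have /cvg_mxP := kC t It; apply.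
Qed.

Lemma Ck0_invmx n (f : R -> 'M[R]_n) : (forall t, I t -> f t \in unitmx) ->
  Ck I 0 f -> Ck I 0 (fun t => invmx (f t)).
Proof.
move=> fU /Ck0P fC; apply/Ck0P => t It.
by apply: cvg_invmx; [exact: fU|exact: fC].
Qed.

(** Splits [f s *m g s - f t *m g t] as [(f s - f t) *m g s + f t *m (g s - g t)]; continuity of [g]
    handles the factor [g s]. *)
Lemma cvg_diff_quot_mulmx m n p (f : R -> 'M[R]_(m, n)) (g : R -> 'M[R]_(n, p))
    t (f' : 'M[R]_(m, n)) (g' : 'M[R]_(n, p)) : Ck I 0 g -> I t ->
  diff_quot f t @ within I t^' --> f' -> diff_quot g t @ within I t^' --> g' ->
  diff_quot (fun s => f s *m g s) t @ within I t^' --> f' *m g t + f t *m g'.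
Proof.
move=> gC It ff' gg'.
have -> : diff_quot (fun s => f s *m g s) t =
          (fun s => diff_quot f t s *m g s + f t *m diff_quot g t s).
  apply/funext => s; rewrite /diff_quot -scalemxAl -scalemxAr -scalerDr.
  by rewrite mulmxBl mulmxBr addrA subrK.
apply: cvgD; apply: cvg_mulmx => //; first exact: Ck0_dnbhs.
exact: cvg_cst.
Qed.

Lemma cvg_diff_quot_trmx m n (f : R -> 'M[R]_(m, n)) t (f' : 'M[R]_(m, n)) :
  diff_quot f t @ within I t^' --> f' ->
  diff_quot (fun s => (f s)^T) t @ within I t^' --> f'^T.
Proof.
have -> : diff_quot (fun s => (f s)^T) t = (fun s => (diff_quot f t s)^T).
  by apply/funext => s; apply/matrixP => i j; rewrite /diff_quot !mxE.
exact: cvg_trmx.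
Qed.

(** Rests on [invmx (f s) - invmx (f t) = - (invmx (f s) *m (f s - f t) *m invmx (f t))], valid when
    [f s] and [f t] are invertible, hence on [I]. *)
Lemma cvg_diff_quot_invmx n (f : R -> 'M[R]_n) t (f' : 'M[R]_n) :
  (forall s, I s -> f s \in unitmx) -> Ck I 0 f -> I t ->
  diff_quot f t @ within I t^' --> f' ->
  diff_quot (fun s => invmx (f s)) t @ within I t^' -->
    - (invmx (f t) *m f' *m invmx (f t)).
Proof.
move=> fU fC It ff'.
have : - (invmx (f s) *m diff_quot f t s *m invmx (f t)) @[s --> within I t^']
    --> - (invmx (f t) *m f' *m invmx (f t)).
  apply: cvgN; apply: cvg_mulmx; last exact: cvg_cst.
  apply: cvg_mulmx => //; exact: (Ck0_dnbhs (Ck0_invmx fU fC)).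
apply: cvg_trans; apply: near_eq_cvg.
rewrite near_withinE; near=> s => Is.
rewrite /diff_quot -scalemxAr -scalemxAl -scalerN mulmxBr mulmxBl.
by rewrite mulVmx ?fU// mul1mx mulmxK ?fU// opprB.
Unshelve. all: by end_near. Qed.

Hypothesis Iperfect : forall t, I t -> ProperFilter (within I t^').

Lemma deriv_on_mulmx m n p (f : R -> 'M[R]_(m, n)) (g : R -> 'M[R]_(n, p)) t :
  Ck I 1 f -> Ck I 1 g -> I t ->
  deriv_on I (fun s => f s *m g s) t = deriv_on I f t *m g t + f t *m deriv_on I g t.
Proof.
move=> [df _] [dg _] It; apply: deriv_on_eq => //.
by apply: cvg_diff_quot_mulmx => //; [exact: derivable_on_continuous|
  exact: derivable_onP|exact: derivable_onP].
Qed.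

Lemma deriv_on_trmx m n (f : R -> 'M[R]_(m, n)) t : Ck I 1 f -> I t ->
  deriv_on I (fun s => (f s)^T) t = (deriv_on I f t)^T.
Proof.
move=> [df _] It; apply: deriv_on_eq => //.
by apply: cvg_diff_quot_trmx; exact: derivable_onP.
Qed.

Lemma Ck1_mulmx m n p (f : R -> 'M[R]_(m, n)) (g : R -> 'M[R]_(n, p)) :
  Ck I 1 f -> Ck I 1 g -> Ck I 1 (fun t => f t *m g t).
Proof.
move=> fC gC; have [fC0 gC0] := (Ck1_Ck0 fC, Ck1_Ck0 gC).
case: fC gC => df f'C [dg g'C].
apply: (Ck1P Iperfect (f' := fun t => deriv_on I f t *m g t + f t *m deriv_on I g t)) => //.
  by move=> t It; apply: cvg_diff_quot_mulmx => //; exact: derivable_onP.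
by apply: Ck0_add; exact: Ck0_mulmx.
Qed.

Lemma Ck1_trmx m n (f : R -> 'M[R]_(m, n)) :
  Ck I 1 f -> Ck I 1 (fun t => (f t)^T).
Proof.
move=> [df f'C]; apply: (Ck1P Iperfect (f' := fun t => (deriv_on I f t)^T)) => //.
  by move=> t It; apply: cvg_diff_quot_trmx; exact: derivable_onP.
exact: Ck0_trmx.
Qed.

Lemma Ck1_invmx n (f : R -> 'M[R]_n) : (forall t, I t -> f t \in unitmx) ->
  Ck I 1 f -> Ck I 1 (fun t => invmx (f t)).
Proof.
move=> fU fC1; have fC := Ck1_Ck0 fC1; case: fC1 => df f'C.
apply: (Ck1P Iperfect (f' := fun t => - (invmx (f t) *m deriv_on I f t *m invmx (f t)))) => //.
  by move=> t It; apply: cvg_diff_quot_invmx => //; exact: derivable_onP.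
have fVC := Ck0_invmx fU fC.
by apply: Ck0_opp; apply: Ck0_mulmx => //; exact: Ck0_mulmx.
Qed.

End MatrixCalculus.

(** * Accumulation in an interval, and congruence of semidefinite matrices *)

Lemma within_itv_dnbhs_proper (R : realType) (a b t : R) : a < b ->
  `[a, b]%classic t -> ProperFilter (within `[a, b]%classic t^').
Proof.
move=> ab; rewrite /= in_itv/= => /andP[a_t tb]; split; last exact: within_filter.
move=> F0.
have {}F0 : nbhs t (fun s : R => s != t -> `[a, b]%classic s -> False) by exact: F0.
(* [F0] says that some punctured neighbourhood of [t] misses the interval. This is refuted by a
   point just right of [t] if [t < b], and just left of it otherwise, where [a < b] leaves room. *)
have [tb'|bt] := ltP t b.
- have F1 : t^'+ (fun s => s != t -> `[a, b]%classic s -> False).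
    exact: cvg_within F0.
  have [s [Fs [ts sb]]] :=
    filter_ex (filterI F1 (filterI (nbhs_right_gt t) (nbhs_right_lt tb'))).
  by apply: Fs; rewrite ?gt_eqF//= in_itv/= (le_trans a_t (ltW ts)) ltW.
- have at' : a < t by exact: lt_le_trans bt.
  have F1 : t^'- (fun s => s != t -> `[a, b]%classic s -> False).
    exact: cvg_within F0.
  have [s [Fs [st sa]]] :=
    filter_ex (filterI F1 (filterI (nbhs_left_lt t) (nbhs_left_gt at'))).
  by apply: Fs; rewrite ?lt_eqF//= in_itv/= (ltW sa) (le_trans (ltW st) tb).
Qed.

(** The new quadratic form at [v] is that of [W] at [D *m v]. *)
Lemma psd_mx_congr (R : realType) k (W D : 'M[R]_k) :
  psd_mx W -> psd_mx (D^T *m W *m D).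
Proof.
move=> [WT W_ge0]; split=> [|v]; first by rewrite !trmx_mul trmxK -WT mulmxA.
by have := W_ge0 (D *m v); rewrite trmx_mul !mulmxA.
Qed.

(** * Pointwise algebra of the transformed coefficients *)

Section Transform.
Context {R : realType} {n m : nat} {I : set R}.
Context {sys : descriptor_system R n m} {U V : R -> 'M[R]_n}.
Hypothesis U_inv : forall t, I t -> U t \in unitmx.
Hypothesis V_inv : forall t, I t -> V t \in unitmx.
Local Notation sys' := (transform I sys U V).

(** The transposed inverse of [U] in the new [Q^T] cancels the [U^T] in the new [E]. *)
Lemma transform_QE t : I t ->
  (sQ sys' t)^T *m sE sys' t = (V t)^T *m ((sQ sys t)^T *m sE sys t) *m V t.
Proof.
move=> /U_inv UU /=.
by rewrite !trmx_mul trmx_inv !mulmxA mulmxKV ?unitmx_tr.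
Qed.

Lemma transform_hamiltonian t x : I t ->
  hamiltonian sys' t x = hamiltonian sys t (V t *m x).
Proof.
move=> It; rewrite /hamiltonian -(mulmxA x^T) transform_QE// trmx_mul.
by rewrite !mulmxA.
Qed.

(* The term with the derivative of V in K' reappears from the product rule. *)
Lemma transform_drift t : I t ->
  sE sys' t *m sK sys' t - sJ sys' t *m sQ sys' t =
  (U t)^T *m ((sE sys t *m sK sys t - sJ sys t *m sQ sys t) *m V t
              + sE sys t *m deriv_on I V t).
Proof.
move=> It; have [UU VV] := (U_inv It, V_inv It) => /=.
by rewrite !mulmxDr !mulmxA !mulmxK// mulmxBr mulmxBl !mulmxA addrAC.
Qed.

(** The factor [U^T] is common to all terms, so it can be cancelled from the state equation; the
    term in the derivative of [V] is the one that the product rule for [V x] absorbs. *)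
Lemma transform_vector_field t : I t ->
  (sJ sys' t - sR sys' t) *m sQ sys' t - sE sys' t *m sK sys' t =
  (U t)^T *m (((sJ sys t - sR sys t) *m sQ sys t - sE sys t *m sK sys t) *m V t
              - sE sys t *m deriv_on I V t).
Proof.
move=> It; have [UU VV] := (U_inv It, V_inv It) => /=.
rewrite !(mulmxBl, mulmxBr) mulmxDr !mulmxA !mulmxK//.
by rewrite opprD addrA.
Qed.

(** The identity block of the congruence reflects that [u] is not transformed. *)
Lemma transform_passivity_mx t : I t ->
  passivity_mx sys' t =
    (block_mx (V t) 0 0 1%:M)^T *m passivity_mx sys t *m block_mx (V t) 0 0 1%:M.
Proof.
move=> It; have UU := U_inv It; rewrite /passivity_mx /=.
rewrite tr_block_mx !mulmx_block.
rewrite !(trmx0, trmx1, mul0mx, mulmx0, mul1mx, mulmx1, addr0, add0r).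
rewrite !trmx_mul !trmxK trmx_inv !mulmxA.
by rewrite !mulmxK// !mulmxKV ?unitmx_tr.
Qed.

(** * Transport of solutions and of the structural conditions *)

Hypothesis Iperfect : forall t, I t -> ProperFilter (within I t^').
Hypothesis V_C1 : Ck I 1 V.

Lemma transform_is_solution x u y :
  is_solution I sys' x u y <-> is_solution I sys (fun t => V t *m x t) u y.
Proof.
have xC : Ck I 1 x <-> Ck I 1 (fun t => V t *m x t).
  split=> xC; first exact: (Ck1_mulmx Iperfect V_C1 xC).
  (* Regularity of [x] is recovered by writing it as the inverse of [V] times [V x], an equality
     that holds on [I]. *)
  apply: (Ck1_eq Iperfect (f := fun t => invmx (V t) *m (V t *m x t))) => [t It|].
    by rewrite mulKmx// V_inv.
  exact: (Ck1_mulmx Iperfect (Ck1_invmx Iperfect V_inv V_C1) xC).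
have state t : Ck I 1 x -> I t ->
    sE sys' t *m deriv_on I x t =
      ((sJ sys' t - sR sys' t) *m sQ sys' t - sE sys' t *m sK sys' t) *m x t
      + (sB sys' t - sP sys' t) *m u t <->
    sE sys t *m deriv_on I (fun s => V s *m x s) t =
      ((sJ sys t - sR sys t) *m sQ sys t - sE sys t *m sK sys t) *m (V t *m x t)
      + (sB sys t - sP sys t) *m u t.
  move=> xC1 It; have [UU VV] := (U_inv It, V_inv It).
  have UT : (U t)^T \in unitmx by rewrite unitmx_tr.
  have -> : sE sys' t *m deriv_on I x t =
      (U t)^T *m (sE sys t *m (V t *m deriv_on I x t)) by rewrite /= !mulmxA.
  have -> : (sB sys' t - sP sys' t) *m u t =
      (U t)^T *m ((sB sys t - sP sys t) *m u t) by rewrite /= -mulmxBr mulmxA.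
  rewrite (deriv_on_mulmx Iperfect)// (mulmxDr (sE sys t)) transform_vector_field//.
  rewrite -(mulmxA (U t)^T _ (x t)) -mulmxDr mulmxBl -!(mulmxA _ _ (x t)).
  (* Both sides of the transformed equation now carry [U^T] on the left: one direction cancels it,
     the other restores it. The rest moves the term [sE sys t *m (deriv_on I V t *m x t)] across the
     equation. *)
  split=> [/(can_inj (mulKmx UT)) ->|e].
    by rewrite addrA [X in X + _]addrC subrK.
  by congr (_ *m _); rewrite addrAC -e addrAC subrr add0r.
have output t : I t -> (sB sys' t + sP sys' t)^T *m sQ sys' t *m x t =
    (sB sys t + sP sys t)^T *m sQ sys t *m (V t *m x t).
  by move=> It; rewrite /= -mulmxDr trmx_mul trmxK !mulmxA mulmxK ?U_inv.
split=> -[xC1 uC sol].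
  split=> [||t It]; [exact: (xC.1 xC1)|exact: uC|have [se ye] := sol t It].
  by split; [exact: (state t xC1 It).1|rewrite -output].
have xC0 := xC.2 xC1.
split=> [||t It]; [exact: xC0|exact: uC|have [se ye] := sol t It].
by split; [exact: (state t xC0 It).2|rewrite output].
Qed.

Lemma transform_QE_C1 : Ck I 1 (fun t => (sQ sys t)^T *m sE sys t) ->
  Ck I 1 (fun t => (sQ sys' t)^T *m sE sys' t).
Proof.
move=> QE_C1.
apply: (Ck1_eq Iperfect (f := fun t => (V t)^T *m ((sQ sys t)^T *m sE sys t) *m V t)).
  by move=> t It; rewrite transform_QE.
exact: (Ck1_mulmx Iperfect (Ck1_mulmx Iperfect (Ck1_trmx Iperfect V_C1) QE_C1) V_C1).
Qed.

Lemma deriv_on_transform_QE t :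
  Ck I 1 (fun t => (sQ sys t)^T *m sE sys t) -> I t ->
  deriv_on I (fun t => (sQ sys' t)^T *m sE sys' t) t =
    (deriv_on I V t)^T *m ((sQ sys t)^T *m sE sys t) *m V t
    + (V t)^T *m deriv_on I (fun t => (sQ sys t)^T *m sE sys t) t *m V t
    + (V t)^T *m ((sQ sys t)^T *m sE sys t) *m deriv_on I V t.
Proof.
move=> QE_C1 It; have VT_C1 := Ck1_trmx Iperfect V_C1.
have VQE_C1 := Ck1_mulmx Iperfect VT_C1 QE_C1.
rewrite -(deriv_on_trmx Iperfect V_C1 It) -mulmxDl.
rewrite -(deriv_on_mulmx Iperfect VT_C1 QE_C1 It).
rewrite -(deriv_on_mulmx Iperfect VQE_C1 V_C1 It).
(* The two functions agree only on [I], so their derivatives are compared through difference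
   quotients. *)
apply: (deriv_on_eq Iperfect It).
have [dVQEV _] := Ck1_mulmx Iperfect VQE_C1 V_C1.
apply: (cvg_diff_quot_eq _ It (derivable_onP dVQEV It)).
by move=> s Is; rewrite transform_QE.
Qed.

(** In the derivative of [V^T (Q^T E) V] the middle term carries the original condition; the two
    outer terms match the contribution of the derivative of [V] to the new drift. *)
Lemma transform_skew_adjoint : skew_adjoint_cond I sys ->
  skew_adjoint_cond I sys'.
Proof.
move=> [QE_C1 skew]; split; first exact: transform_QE_C1.
move=> t It; have [QE_sym dQE] := skew t It; split.
  (* The right side is the transpose of the left, so symmetry passes through the congruence by
     [V]. *)
  rewrite transform_QE// -[in RHS](trmxK (sQ sys' t)) -trmx_mul transform_QE//.
  by rewrite !trmx_mul !trmxK QE_sym !mulmxA.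
rewrite deriv_on_transform_QE// dQE transform_drift//.
have QU : (sQ sys' t)^T *m (U t)^T = (V t)^T *m (sQ sys t)^T.
  by rewrite /= !trmx_mul trmx_inv !mulmxA mulmxKV ?unitmx_tr ?U_inv.
rewrite (mulmxA _ (U t)^T) QU (trmx_mul (U t)^T) trmxK -(mulmxA _ (U t)).
have -> : U t *m sQ sys' t = sQ sys t *m V t.
  by rewrite /= !mulmxA mulmxV ?U_inv// mul1mx.
(* Only the term with the transposed derivative of [V] needs [Q^T E] turned into [E^T Q], since it
   must match a summand of the transposed drift. The drift [E K - J Q] itself stays opaque as
   [G]. *)
rewrite {1}QE_sym; move: (_ - _) => G.
rewrite [(_ + _)^T]linearD /= !trmx_mul !(mulmxDl, mulmxDr) !mulmxA.
by rewrite [RHS]addrACA -[LHS]addrA addrCA; congr (_ + _); rewrite addrC.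
Qed.

(** Multiplication by [V] sends solutions to solutions of the original system with equal
    Hamiltonian, so the same [h0] serves. *)
Lemma transform_hamiltonian_bounded_below : hamiltonian_bounded_below I sys ->
  hamiltonian_bounded_below I sys'.
Proof.
move=> [h0 h0P]; exists h0 => x u y /transform_is_solution xuy t It.
by rewrite transform_hamiltonian//; exact: h0P xuy t It.
Qed.

Hypothesis U_C0 : Ck I 0 U.

Lemma transform_pHDAE0 : pHDAE I 0 sys -> pHDAE I 0 sys'.
Proof.
have V_C0 : Ck I 0 V := Ck1_Ck0 V_C1.
have UT_C0 := Ck0_trmx U_C0.
have UV_C0 := Ck0_invmx U_inv U_C0.
have VV_C0 := Ck0_invmx V_inv V_C0.
move=> [[E_C0 Q_C0 J_C0 R_C0 K_C0] [B_C0 P_C0 S_C0 N_C0 SN] skew Hbd [W_C0 W_psd]].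
split.
- split.
  + exact: (Ck0_mulmx (Ck0_mulmx UT_C0 E_C0) V_C0).
  + exact: (Ck0_mulmx (Ck0_mulmx UV_C0 Q_C0) V_C0).
  + exact: (Ck0_mulmx (Ck0_mulmx UT_C0 J_C0) U_C0).
  + exact: (Ck0_mulmx (Ck0_mulmx UT_C0 R_C0) U_C0).
  + apply: (Ck0_add (Ck0_mulmx (Ck0_mulmx VV_C0 K_C0) V_C0)).
    (* Continuity of the extra summand of the new [K] is where continuity of the derivative of [V]
       enters. *)
    exact: (Ck0_mulmx VV_C0 V_C1.2).
- by split; [exact: (Ck0_mulmx UT_C0 B_C0)|exact: (Ck0_mulmx UT_C0 P_C0)
            |exact: S_C0|exact: N_C0|exact: SN].
- exact: transform_skew_adjoint.
- exact: transform_hamiltonian_bounded_below.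
pose D t : 'M[R]_(n + m) := block_mx (V t) 0 0 1%:M.
have D_C0 : Ck I 0 D.
  by apply: Ck0_block_mx; [exact: V_C0|exact: Ck0_cst..].
split; last by move=> t It; rewrite transform_passivity_mx//; exact/psd_mx_congr/W_psd.
apply: (Ck0_eq (f := fun t => (D t)^T *m passivity_mx sys t *m D t)).
  by move=> t It; rewrite transform_passivity_mx.
exact: (Ck0_mulmx (Ck0_mulmx (Ck0_trmx D_C0) W_C0) D_C0).
Qed.

(** Only the clauses on [E] and [Q] depend on the regularity index; the others come from the case
    0. *)
Lemma transform_pHDAE1 : pHDAE I 1 sys -> Ck I 1 U -> pHDAE I 1 sys'.
Proof.
move=> sys1 U_C1; have [[_ _ J' R' K'] BP skew H W] := transform_pHDAE0 (pHDAE1_0 sys1).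
have [[E_C1 Q_C1 _ _ _] _ _ _ _] := sys1.
split; [|exact: BP|exact: skew|exact: H|exact: W].
have UT_C1 := Ck1_trmx Iperfect U_C1.
have UV_C1 := Ck1_invmx Iperfect U_inv U_C1.
split; [|  |exact: J'|exact: R'|exact: K'].
  exact: (Ck1_mulmx Iperfect (Ck1_mulmx Iperfect UT_C1 E_C1) V_C1).
exact: (Ck1_mulmx Iperfect (Ck1_mulmx Iperfect UV_C1 Q_C1) V_C1).
Qed.

End Transform.

Theorem theorem12 (R : realType) (n m : nat) (t0 tf : R) (I : set R)
    (t0_lt_tf : t0 < tf) (I_def : I = `[t0, tf]%classic)
    (sys : descriptor_system R n m) (sys_pHDAE : pHDAE I 0 sys)
    (U V : R -> 'M[R]_n) (U_C0 : Ck I 0 U) (V_C1 : Ck I 1 V)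
    (U_inv : forall t, I t -> U t \in unitmx)
    (V_inv : forall t, I t -> V t \in unitmx) :
  let sys' := transform I sys U V in
  [/\ pHDAE I 0 sys',
      (pHDAE I 1 sys -> Ck I 1 U -> pHDAE I 1 sys'),
      (forall (x' : R -> 'cV[R]_n) (u y : R -> 'cV[R]_m),
         is_solution I sys' x' u y <->
         is_solution I sys (fun t => V t *m x' t) u y) &
      (forall (t : R) (x' : 'cV[R]_n), I t ->
         hamiltonian sys' t x' = hamiltonian sys t (V t *m x'))].
Proof.
move=> sys'; have Iperfect t : I t -> ProperFilter (within I t^').
  by rewrite I_def; exact: within_itv_dnbhs_proper.
split=> [|sys1 U_C1|x' u y|t x' It].
- exact: transform_pHDAE0.
- exact: transform_pHDAE1.
- exact: transform_is_solution.
- exact: transform_hamiltonian.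
Qed.
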